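(* For each $\ell\in\{1,\dots,N\}$, \[\mathrm{mR}(\lambda^{k^*_\ell}_\ell)\le\mathcal{O}\big(|V|^{(|V|+3)\cdot(|\Pi\setminus J_\ell|+2)}\big)\quad\text{and}\quad \mathrm{mR}(\lambda^{k^*_\ell}_{\ge\ell})\le\mathcal{O}\big(|V|^{(|V|+3)\cdot(|\Pi|+2)}\big).\] In particular $\mathrm{mR}(\lambda^* )\le\mathcal{O}\big(|V|^{(|V|+3)\cdot(|\Pi|+2)}\big)$.
   Context: Let $\mathcal{G}$ be a quantitative reachability game on an arena $G=(\Pi,V,(V_i)_{i\in\Pi},E)$ (finite player set $\Pi$, finite vertex set $V$ with $|V|\ge 2$ and $|\Pi|\le|V|$, partition $(V_i)$, every vertex has a successor) with target sets $F_i\subseteq V$ and costs $\mathrm{Cost}_i(\rho)=$ least $k$ with $\rho_k\in F_i$ (or $+\infty$), and let $v_0\in V$. Extended game: arena $X$ with vertices $V^X=V\times2^\Pi$, edges $((v,I),(v',I'))$ iff $(v,v')\in E$ and $I'=I\cup\{i: v'\in F_i\}$, $(v,I)\in V^X_i$ iff $v\in V_i$, targets $F^X_i=\{(v,I):i\in I\}$, costs $\mathrm{Cost}_i$ (reachability cost w.r.t. $F^X_i$); $x_0=(v_0,\{i:v_0\in F_i\})$. $I(u)$ is the second component of $u\in V^X$. $\mathcal{I}$ is the set of sets $I$ such that some $(v,I)$ is reachable from $x_0$, $N=|\mathcal{I}|$, and $J_1<\dots<J_N$ is a fixed total order of $\mathcal{I}$ extending the partial order $I<I'$ iff $I\neq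 I'$ and some $(v',I')$ is reachable from some $(v,I)$. $V^{J_n}=\{(v,J_n):v\in V\}$, $V^{\ge J_n}=\bigcup_{m\ge n}V^{J_m}$. Labelings: for $\lambda:V^X\to\mathbb{N}\cup\{+\infty\}$, a play $\rho$ of $X$ is $\lambda$-consistent if $\mathrm{Cost}_i(\rho_{\ge n})\le\lambda(\rho_n)$ whenever $\rho_n\in V^X_i$. $\lambda^0(u)=0$ if $u\in V^X_i$ and $i\in I(u)$, $+\infty$ otherwise. The update of $\lambda^k$ w.r.t. $V^{\ge J_n}$ keeps $\lambda^k$ outside $V^{\ge J_n}$ and, for $u\in V^{\ge J_n}\cap V^X_i$, sets $\lambda^{k+1}(u)=0$ if $i\in I(u)$ and otherwise $1+\min_{(u,u')\in E^X}\sup\{\mathrm{Cost}_i(\rho):\rho \text{ a } \lambda^k\text{-consistent play from } u'\}$ (with $1+(+\infty)=+\infty$). The sequence $(\lambda^k)$ is generated with $n_0=N$, $\lambda^{k+1}=$ update of $\lambda^k$ w.r.t. $V^{\ge J_{n_k}}$, $n_{k+1}=n_k-1$ if $\lambda^{k+1}=\lambda^k$ and $n_k>1$, else $n_{k+1}=n_k$. Let $k^*_N=0$ and, for $\ell<N$, $k^*_\ell$ be the least $k>k^*_{\ell+1}$ with $\lambda^{k+1}=\lambda^k$ (these are finite); $\lambda^*=\lambda^{k^*_1}$, which satisfies $\lambda^{k^*_1+m}=\lambda^*$ for all $m$. Maximal finite range: for a function $f$ with values in $\mathbb{N}\cup\{+\infty\}$, $\mathrm{mR}(f)$ is the maximum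 of its finite values, and $0$ if it has none. For a labeling $\lambda$, $\lambda_n$ and $\lambda_{\ge n}$ denote its restrictions to $V^{J_n}$ and $V^{\ge J_n}$ (so $\mathrm{mR}(\lambda_n)=0$ when $J_n$ is a bottom region). The $\mathcal{O}$ is with respect to the game parameters $|V|,|\Pi|$. *)

(* Defs.v *)
From mathcomp Require Import all_boot.
From Stdlib Require Import ClassicalEpsilon.
Set Implicit Arguments. Unset Strict Implicit. Unset Printing Implicit Defensive.

(* N ∪ {+oo}: [Some n] is n, [None] is +oo. *)
Notation enat := (option nat).

Definition ele (x y : enat) : Prop :=
  match x, y with
  | _, None => True
  | None, Some _ => False
  | Some a, Some b => (a <= b)%N
  end.

Definition eS (x : enat) : enat := omap S x.

Definition emin (x y : enat) : enat :=
  match x, y with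
  | None, y => y
  | x, None => x
  | Some a, Some b => Some (minn a b)
  end.

(* supremum in N ∪ {+oo} of a set of values (sup of the empty set = 0) *)
Definition ub (S : enat -> Prop) (n : nat) : Prop := forall x, S x -> ele x (Some n).
Definition esup (S : enat -> Prop) : enat :=
  match excluded_middle_informative (exists n, ub S n) with
  | left _ => Some (epsilon (inhabits 0%N)
                     (fun n => ub S n /\ forall m, ub S m -> (n <= m)%N))
  | right _ => None
  end.

(* A quantitative reachability game: vertices, players, owner function
   (encoding the partition (V_i)), edges, target sets, initial vertex. *)
Record game := Game {
  gV : finType;
  gPi : finType;
  owner : gV -> gPi;
  edge : rel gV;
  target : gPi -> {set gV};
  v0 : gV
}.

Notation XV G := (prod (gV G) {set gPi G}).

Definition newI (G : game) (v : gV G) : {set gPi G} := [set i | v \in target i].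

Definition Xedge (G : game) : rel (XV G) :=
  fun u u' => edge u.1 u'.1 && (u'.2 == u.2 :|: newI u'.1).

Definition Xowner (G : game) (u : XV G) : gPi G := owner u.1.

Definition x0 (G : game) : XV G := (v0 G, newI (v0 G)).

Definition is_play (G : game) (r : nat -> XV G) : Prop :=
  forall n, Xedge (r n) (r n.+1).

(* Cost_i w.r.t. F^X_i = {(v,I) | i \in I}: least k with i \in I(r k), or +oo *)
Definition cost (G : game) (i : gPi G) (r : nat -> XV G) : enat :=
  match excluded_middle_informative (exists k, i \in (r k).2) with
  | left H => Some (ex_minn H)
  | right _ => None
  end.

Definition sfx (G : game) (r : nat -> XV G) (n : nat) : nat -> XV G :=
  fun k => r (n + k)%N.

Definition labeling (G : game) := XV G -> enat.

Definition consistent (G : game) (lam : labeling G) (r : nat -> XV G) : Prop :=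
  forall n, ele (cost (Xowner (r n)) (sfx r n)) (lam (r n)).

Definition inI (G : game) (I : {set gPi G}) : bool :=
  [exists v : gV G, connect (@Xedge G) (x0 G) (v, I)].

Definition precI (G : game) (I I' : {set gPi G}) : bool :=
  (I != I') && [exists v : gV G, exists v' : gV G, connect (@Xedge G) (v, I) (v', I')].

Definition valid_order (G : game) (Js : seq {set gPi G}) : Prop :=
  [/\ uniq Js,
      (forall I, (I \in Js) = inI I) &
      (forall a b, (a < size Js)%N -> (b < size Js)%N ->
         precI (nth set0 Js a) (nth set0 Js b) -> (a < b)%N)].

(* J_n, 1-based *)
Definition Jn (G : game) (Js : seq {set gPi G}) (n : nat) : {set gPi G} :=
  nth set0 Js n.-1.

Definition inEq (G : game) (Js : seq {set gPi G}) (n : nat) (u : XV G) : bool :=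
  (u.2 \in Js) && ((index u.2 Js).+1 == n).

Definition inGe (G : game) (Js : seq {set gPi G}) (n : nat) (u : XV G) : bool :=
  (u.2 \in Js) && (n <= (index u.2 Js).+1)%N.

Definition lam0 (G : game) : labeling G :=
  fun u => if Xowner u \in u.2 then Some 0%N else None.

Definition supcost (G : game) (lam : labeling G) (i : gPi G) (u' : XV G) : enat :=
  esup (fun c => exists r, [/\ is_play r, r 0%N = u', consistent lam r & c = cost i r]).

Definition update (G : game) (Js : seq {set gPi G}) (lam : labeling G) (n : nat) : labeling G :=
  fun u =>
    if inGe Js n u then
      if Xowner u \in u.2 then Some 0%N
      else eS (foldr emin None
                 [seq supcost lam (Xowner u) u' | u' <- enum [pred u' | Xedge u u']])
    else lam u.

Definition feq (G : game) (f g : labeling G) : bool := [forall u : XV G, f u == g u].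

Fixpoint lseq (G : game) (Js : seq {set gPi G}) (k : nat) : labeling G * nat :=
  match k with
  | 0 => (@lam0 G, size Js)
  | k'.+1 =>
      let (l, n) := lseq Js k' in
      let l' := update Js l n in
      (l', if feq l' l && (1 < n)%N then n.-1 else n)
  end.

Definition lam (G : game) (Js : seq {set gPi G}) (k : nat) : labeling G := (lseq Js k).1.

Definition stableAt (G : game) (Js : seq {set gPi G}) (k : nat) : bool :=
  feq (lam Js k.+1) (lam Js k).

(* kstar_d d k  <->  k = k^*_{N-d} *)
Fixpoint kstar_d (G : game) (Js : seq {set gPi G}) (d k : nat) : Prop :=
  match d with
  | 0 => k = 0%N
  | d'.+1 => exists k', [/\ kstar_d Js d' k', (k' < k)%N, stableAt Js k &
                          forall j, (k' < j < k)%N -> ~~ stableAt Js j]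
  end.

Definition IsKstar (G : game) (Js : seq {set gPi G}) (l k : nat) : Prop :=
  kstar_d Js (size Js - l) k.

(* maximal finite range of lam restricted to A (0 if no finite value) *)
Definition mR_on (G : game) (A : pred (XV G)) (f : labeling G) : nat :=
  \max_(u | A u) odflt 0%N (f u).

(* Main.v *)
(** The bound holds for every labeling of the sequence, whatever the regions
    being updated.  Let [n] be the number of vertices.  If the supremum of
    [Cost_i] over the consistent plays from a vertex is finite, a consistent play
    cannot stay [n] steps in a region without having a pending finite
    constraint: otherwise it would repeat a vertex and could loop there forever.
    A pending finite constraint forces the play to leave the region before it
    expires.  Hence a new label in a region [I] is at most
    [2 * K + 1 + n + (d - 1) * (n + M)], where [d] is the number of players outside
    [I], and [K] and [M] bound the finite labels of [I] and of the larger regions.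
    As labels never increase, [K] can only grow when one of the [n] labels of [I]
    turns finite; this yields a factor [2 ^ n <= n ^ n] per level [d]. *)

Require Import Defs.
From mathcomp Require Import all_boot.
From mathcomp Require Import zify.
From Stdlib Require Import ClassicalEpsilon.
Set Implicit Arguments. Unset Strict Implicit. Unset Printing Implicit Defensive.

(** * Order, minima and suprema in the extended naturals *)

Lemma ele_refl x : ele x x.
Proof. by case: x => /=. Qed.

Lemma ele_trans y x z : ele x y -> ele y z -> ele x z.
Proof. case: x y z => [a|] [b|] [c|] //=; exact: leq_trans. Qed.

Lemma eS_mono x y : ele x y -> ele (eS x) (eS y).
Proof. by case: x y => [a|] [b|]. Qed.

Lemma emin_mono x y x' y' : ele x x' -> ele y y' -> ele (emin x y) (emin x' y').
Proof. case: x y x' y' => [a|] [b|] [a'|] [b'|] //=; lia. Qed.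

Lemma foldr_emin_mono (T : Type) (f g : T -> enat) s :
  (forall x, ele (f x) (g x)) ->
  ele (foldr emin None (map f s)) (foldr emin None (map g s)).
Proof. by move=> fg; elim: s => //= x s IH; apply: emin_mono. Qed.

Lemma foldr_emin_Some (T : eqType) (f : T -> enat) s a :
  foldr emin None (map f s) = Some a -> exists2 x, x \in s & f x = Some a.
Proof.
have wk x (s' : seq T) : (exists2 y, y \in s' & f y = Some a) ->
    exists2 y, y \in x :: s' & f y = Some a.
  by case=> y ys fy; exists y; rewrite // inE ys orbT.
elim: s => [//|x s IH]; rewrite [map _ _]/= [foldr _ _ _]/=.
case E: (f x) => [b|]; last by move=> H; apply/wk/IH.
case F: (foldr _ _ _) => [c|] [Ea]; last first.
  by exists x; rewrite ?mem_head // E Ea.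
move: Ea; rewrite /minn; case: ifP => _ Ea.
  by exists x; rewrite ?mem_head // E Ea.
by apply/wk/IH; rewrite F Ea.
Qed.

Lemma esup_Some S n :
  esup S = Some n -> ub S n /\ forall m, ub S m -> n <= m.
Proof.
rewrite /esup; case: excluded_middle_informative => // -[m0 ubm0] [<-].
apply: (epsilon_spec (inhabits 0)
  (fun n => ub S n /\ forall m, ub S m -> (n <= m)%N)).
(* [ub S] is not decidable, so its least element comes from a classical strong induction. *)
have [m []] : exists m, ub S m /\ forall k, k < m -> ~ ub S k.
  elim/ltn_ind: m0 ubm0 => m IH ubm.
  case: (classic (exists2 k, k < m & ub S k)) => [[k /IH]|no]; first exact.
  by exists m; split=> // k km ubk; apply: no; exists k.
move=> ubm least; exists m; split=> // k ubk.
by rewrite leqNgt; apply/negP => /least; apply.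
Qed.

Lemma esup_mono (S S' : enat -> Prop) :
  (forall x, S x -> S' x) -> ele (esup S) (esup S').
Proof.
move=> SS'; case E': (esup S') => [n'|]; last by case: (esup S).
have [ubn' _] := esup_Some E'.
have ubS : ub S n' by move=> x /SS' /ubn'.
case E: (esup S) => [n|] /=; first by have [_] := esup_Some E; apply.
by move: E; rewrite /esup; case: excluded_middle_informative => //; case; exists n'.
Qed.

Section Game.
Variable G : game.
Implicit Types (Js : seq {set gPi G}) (lam : labeling G) (r : nat -> XV G) (i : gPi G).
Definition nverts := #|gV G|.
Local Notation n := nverts.

(** * Costs along plays, and lasso plays *)

Lemma costP i r L :
  ele (cost i r) (Some L) <-> exists2 k, k <= L & i \in (r k).2.
Proof.
rewrite /cost; case: excluded_middle_informative => [ex|nex] /=; last first.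
  by split=> // -[k _ ik]; apply: nex; exists k.
case: ex_minnP => m im minm; split=> [mL|[k kL ik]]; first by exists m.
exact: leq_trans (minm _ ik) kL.
Qed.

Lemma cost_None i r : (forall k, i \notin (r k).2) -> cost i r = None.
Proof.
move=> H; rewrite /cost; case: excluded_middle_informative => // -[k ik].
by have := H k; rewrite ik.
Qed.

Lemma play_sub r s t : is_play r -> s <= t -> (r s).2 \subset (r t).2.
Proof.
move=> pr /subnKC <-; elim: (t - s) => [|k IH]; first by rewrite addn0.
apply: subset_trans IH _; rewrite addnS.
by have /andP[_ /eqP->] := pr (s + k); apply: subsetUl.
Qed.

Definition lasso a b k := if k < a then k else a + (k - a) %% (b - a).

Lemma lasso_play r a b :
  is_play r -> a < b -> r a = r b -> is_play (r \o lasso a b).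
Proof.
move=> pr ab rab k; suff -> : (r \o lasso a b) k.+1 = r (lasso a b k).+1 by exact: pr.
rewrite /= /lasso; case: (ltngtP k.+1 a) => [ka|ak|ka].
- by [].
- have -> : k.+1 - a = (k - a).+1 by lia.
  (* When the index wraps, position [b - 1] is followed by [a], which is an edge because
     [r a = r b]. *)
  rewrite modnS; case: ifP => [dv|_]; last by rewrite addnS.
  have Em : ((k - a) %% (b - a)).+1 = b - a.
    case/dvdnP: dv => -[|q] Eq; first by lia.
    have -> : k - a = q * (b - a) + (b - a).-1 by rewrite mulSn in Eq; lia.
    by rewrite modnMDl modn_small; lia.
  by rewrite addn0 -addnS Em subnKC // ltnW.
- by rewrite ka subnn mod0n addn0.
Qed.

(* If every finite constraint met before [b] is already discharged at [b], the
   cycle from [a] to [b] may be repeated forever. *)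
Lemma lasso_consistent lam r a b :
  is_play r -> consistent lam r -> a < b -> r a = r b ->
  (forall s, s <= b -> lam (r s) != None -> Xowner (r s) \in (r b).2) ->
  consistent lam (r \o lasso a b).
Proof.
move=> pr cr ab rab done_b k.
have lb : lasso a b k <= b.
  rewrite /lasso; case: ifP => ka; first by lia.
  by have := ltn_pmod (k - a) (d := b - a) ltac:(lia); lia.
rewrite [(r \o _) k]/=; case E: (lam _) => [L|]; last by case: (cost _ _).
have own : Xowner (r (lasso a b k)) \in (r a).2 by rewrite rab done_b ?E.
apply/costP; have [al|la] := leqP a (lasso a b k).
  exists 0 => //; rewrite /sfx addn0 /=.
  exact: (subsetP (play_sub pr al)).
have kE : lasso a b k = k by move: la; rewrite /lasso; case: ifP => //; lia.
rewrite kE in la own E *.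
have := cr k; rewrite E => /costP[m mL om].
(* The lasso may differ from [r] after [a]; if [k + m] lies there, position [a] is an earlier
   witness. *)
have [kma|akm] := leqP (k + m) a; last first.
  exists (a - k); first by lia.
  by rewrite /sfx /= subnKC ?(ltnW la) // /lasso ltnn subnn mod0n addn0.
exists m => //; rewrite /sfx /= /lasso; case: ltngtP kma => // kma _.
by rewrite -kma subnn mod0n addn0 kma.
Qed.

(** By monotonicity the second component is constant on the window, so the pigeonhole principle
    applies to the [n + 1] first components. *)
Lemma play_repeat r t :
  is_play r -> (r (t + n)).2 = (r t).2 ->
  exists a b, [/\ t <= a, a < b, b <= t + n & r a = r b].
Proof.
move=> pr It.
have same k : t <= k <= t + n -> (r k).2 = (r t).2.
  move=> /andP[tk kn]; apply/eqP; rewrite eqEsubset -{1}It.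
  by rewrite !play_sub.
have /injectivePn[x [y xy fxy]] :
    ~~ injectiveb (fun k : 'I_n.+1 => (r (t + k)).1).
  by apply/negP => /injectiveP /leq_card; rewrite card_ord ltnn.
wlog lt_xy : x y xy fxy / x < y.
  move=> H; case: (ltngtP x y) => [|yx|/val_inj E]; first exact: H.
    by apply: (H y x); rewrite // eq_sym.
  by rewrite E eqxx in xy.
have yn : y <= n := leq_ord y.
exists (t + x), (t + y); split; rewrite ?leq_addr ?ltn_add2l ?leq_add2l //.
apply/eqP; rewrite -pair_eqE /pair_eq fxy eqxx !same ?leq_addr ?leq_add2l //=.
exact: ltnW (leq_trans lt_xy yn).
Qed.

(** * How long a consistent play can delay a target *)

(** Consequence of a finite [supcost lam i u]: a finite upper bound on the costs excludes [None]. *)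
Definition unavoidable lam i (u : XV G) :=
  forall r, is_play r -> r 0 = u -> consistent lam r -> cost i r <> None.

(** The position [s] may precede [t]: a constraint inherited from an earlier region can also be what
    prevents looping. *)
Lemma leave_region lam i r t :
  unavoidable lam i (r 0) -> is_play r -> consistent lam r ->
  i \notin (r t).2 ->
  exists t', [/\ t <= t', (r t').2 != (r t).2 &
    t' <= t + n \/ exists s L, [/\ s <= t + n, lam (r s) = Some L,
                                   Xowner (r s) \notin (r t).2 & t' <= s + L]].
Proof.
move=> una pr cr it; have [Itn|] := eqVneq (r (t + n)).2 (r t).2; last first.
  by exists (t + n); split=> //; [lia|left].
have [a [b [ta ab bt rab]]] := play_repeat pr Itn.
have Ib : (r b).2 = (r t).2.
  by apply/eqP; rewrite eqEsubset -{1}Itn !play_sub //; lia.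
case: (pickP (fun s : 'I_b.+1 =>
    (lam (r s) != None) && (Xowner (r s) \notin (r t).2))) => [s|noS].
  case E: (lam (r s)) => [L|] //= os.
  have := cr s; rewrite E => /costP[k kL ok].
  exists (s + k); split.
  - rewrite leqNgt; apply: contraNN os => st.
    exact: (subsetP (play_sub pr (ltnW st))).
  - by apply: contraNneq os => <-.
  - by right; exists s, L; have := ltn_ord s; split=> //; lia.
case: (una (r \o lasso a b)).
- exact: lasso_play.
- by rewrite /= /lasso; case: ifP => //; case: (a) => // _; rewrite mod0n.
- apply: lasso_consistent => // s sb fs; rewrite Ib.
  have sb1 : s < b.+1 by [].
  by have := noS (Ordinal sb1); rewrite /= fs => /negbFE.
apply: cost_None => k /=; apply: contraNN it; rewrite -Ib.
apply/subsetP/play_sub => //; rewrite /lasso; case: ifP => ka; first by lia.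
by have := ltn_pmod (k - a) (d := b - a) ltac:(lia); lia.
Qed.

(* Constraints created in the region [I0] delay the play twice: up to [K] steps
   until it leaves [I0], and up to [K] more until they have all expired.
   Afterwards each of the remaining regions takes at most [n + M] steps. *)
Lemma cost_bound lam i r (I0 : {set gPi G}) K M :
  unavoidable lam i (r 0) -> is_play r -> consistent lam r ->
  i \notin I0 -> I0 \subset (r 0).2 ->
  (forall (u : XV G) x, u.2 = I0 -> lam u = Some x -> x <= K) ->
  (forall (u : XV G) x, I0 \proper u.2 -> lam u = Some x -> x <= M) ->
  ele (cost i r) (Some (K.*2 + n + #|~: I0|.-1 * (n + M))).
Proof.
move=> una pr cr iI0 I0r leK leM.
have sub0 t : I0 \subset (r t).2 by apply: subset_trans I0r (play_sub pr _).
have [t1 t1le It1] : exists2 t1, t1 <= n + K & (r t1).2 != I0.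
  have [I00|ne] := eqVneq (r 0).2 I0; last by exists 0.
  have i0 : i \notin (r 0).2 by rewrite I00.
  have [t [_ It]] := leave_region una pr cr i0; rewrite I00 in It.
  case=> [tn|[s [L [sn Ls os tL]]]]; first by exists t => //; lia.
  have [Is|ne] := eqVneq (r s).2 I0; last by exists s => //; lia.
  by exists t => //; have := leK _ _ Is Ls; lia.
have late t : t1 <= t -> I0 \proper (r t).2.
  move=> t1t; rewrite properEneq sub0 andbT eq_sym.
  apply: contraNneq It1 => It; rewrite eqEsubset sub0 andbT -It.
  exact: play_sub.
have tail d t : t1 + K <= t -> #|~: (r t).2| <= d ->
    ele (cost i r) (Some (t + d * (n + M))).
  elim: d t => [|d IH] t t1t dt.
    apply/costP; exists t; first by lia.
    by move: dt; rewrite leqn0 cards_eq0 => /eqP/setP/(_ i); rewrite !inE => /negbFE.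
  have [it|it] := boolP (i \in (r t).2); first by apply/costP; exists t => //; lia.
  have [t' [tt' It' t'le]] := leave_region una pr cr it.
  have t'b : t' <= t + (n + M).
    case: t'le => [|[s [L [sn Ls os tL]]]]; first by lia.
    have [Is|ne] := eqVneq (r s).2 I0; last first.
      suff: L <= M by lia.
      by apply: leM Ls; rewrite properEneq eq_sym ne sub0.
    (* A constraint created in [I0] dates from before [t1] and is discharged by [t1 + K], so its
       owner is already in [(r t).2]. *)
    case/negP: os; have := cr s; rewrite Ls => /costP[k kL].
    rewrite /sfx; apply/subsetP/play_sub => //; have := leK _ _ Is Ls.
    have : s < t1 by rewrite ltnNge; apply/negP => /late; rewrite Is properxx.
    lia.
  have : #|~: (r t').2| < #|~: (r t).2|.
    apply: proper_card; rewrite properEneq setCS play_sub // andbT.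
    by rewrite (inj_eq (@setC_inj _)).
  move=> lt; apply: ele_trans (IH t' _ _) _ => /=; lia.
apply: ele_trans (tail #|~: I0|.-1 (t1 + K) _ _) _ => //=; last by lia.
(* Leaving [I0] has added a player, whence the [.-1] in the bound. *)
have : #|~: (r (t1 + K)).2| < #|~: I0|.
  apply: proper_card.
  by have := late (t1 + K) (leq_addr _ _); rewrite /proper !setCS.
lia.
Qed.

(** * The update operator *)

Definition Phi lam : labeling G := fun u =>
  if Xowner u \in u.2 then Some 0
  else eS (foldr emin None
             [seq supcost lam (Xowner u) u' | u' <- enum [pred u' | Xedge u u']]).

Lemma updateE Js lam l u :
  update Js lam l u = if inGe Js l u then Phi lam u else lam u.
Proof. by []. Qed.

(** Smaller labels leave fewer consistent plays, hence smaller suprema. *)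
Lemma Phi_mono lam lam' u :
  (forall w, ele (lam w) (lam' w)) -> ele (Phi lam u) (Phi lam' u).
Proof.
move=> le; rewrite /Phi; case: ifP => // _; apply: eS_mono.
apply: foldr_emin_mono => w; apply: esup_mono => c [r [pr r0 cr ->]].
by exists r; split=> // k; apply: ele_trans (cr k) (le _).
Qed.

(** * Numerical bounds *)

(** Bound on the finite labels of a region lacking [d] players, with [m] vertices; [gbound m d']
    serves for the larger regions. When no player is lacking, all labels of the sequence are [0]. *)
Fixpoint gbound (m d : nat) : nat :=
  if d is d'.+1 then (2 ^ m - 1) * (m.+1 + d' * (m + gbound m d')) else 0.

Lemma gbound_mono m d d' : d <= d' -> gbound m d <= gbound m d'.
Proof.
move=> /subnKC <-; elim: (d' - d) => [|k IH]; first by rewrite addn0.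
apply: leq_trans IH _; rewrite addnS.
elim: (d + k) => [//|e IH]; rewrite [gbound m e.+1]/= [gbound m e.+2]/=.
rewrite leq_mul2l; apply/orP; right.
by rewrite leq_add2l leq_mul // leq_add2l.
Qed.

(** Each level costs a factor [m ^ (m + 3)]: [m ^ m] dominates [2 ^ m - 1], and [m ^ 3] absorbs the
    other factor since [d <= m]. *)
Lemma gbound_le m d : 2 <= m -> d <= m -> gbound m d <= m ^ ((m + 3) * (d + 2)).
Proof.
move=> m2; elim: d => [//|d IH dm].
have {}IH := IH (ltnW dm).
have -> : (m + 3) * (d.+1 + 2) = m + (3 + (m + 3) * (d + 2)) by lia.
rewrite expnD /=; apply: leq_mul.
  by apply: leq_trans (leq_subr _ _) _; rewrite leq_exp2r //; lia.
have : 1 < m ^ ((m + 3) * (d + 2)) by rewrite -{1}(expn0 m) ltn_exp2l //; lia.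
rewrite expnD; move: (m ^ ((m + 3) * _)) (gbound m d) IH => X g gX X1.
have h1 : d * (m + g) <= m * m + m * X.
  by apply: leq_trans (_ : m * (m + X) <= _); [apply: leq_mul; lia|rewrite mulnDr].
have h3 : m ^ 3 = m * m * m by rewrite !expnS expn0; lia.
have h4 : 2 * m <= m * m by rewrite leq_mul2r m2 orbT.
have h4' : 2 * (m * m) <= m * m * m by rewrite -mulnA leq_mul2r m2 orbT.
(* A share [m * X] of [m ^ 3 * X] is kept for the recursive term; the rest covers the terms without
   [X] because [X >= 2]. *)
have h5 : m.+1 + m * m <= (m * m * m - m) * X.
  by apply: leq_trans (_ : (m * m * m - m) * 2 <= _); [lia|apply: leq_mul].
rewrite h3; have : (m * m * m - m) * X + m * X = m * m * m * X.
  by rewrite -mulnDl subnK //; lia.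
lia.
Qed.

(** * The invariant of the label sequence *)

Definition numfin lam (I : {set gPi G}) := #|[pred v | lam (v, I) != None]|.

(* [(2 ^ m - 1) * c] is the [m]-th iterate of [K |-> 2 * K + c] at [0], and each
   step which can increase the labels of a region makes one more of them finite. *)
Definition region_bound (d m : nat) : nat :=
  (2 ^ m - 1) * (n.+1 + d.-1 * (n + gbound n d.-1)).

Lemma region_bound_mono d m m' : m <= m' -> region_bound d m <= region_bound d m'.
Proof.
move=> mm; rewrite /region_bound leq_mul2r; apply/orP; right.
by apply: leq_sub2r; rewrite leq_pexp2l.
Qed.

Lemma region_boundS d m :
  region_bound d m.+1 =
  (region_bound d m).*2 + (n.+1 + d.-1 * (n + gbound n d.-1)).
Proof.
rewrite /region_bound expnS; move: (n.+1 + _) => c.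
have : 0 < 2 ^ m by rewrite expn_gt0.
move: (2 ^ m) => p p0; have -> : 2 * p - 1 = (p - 1).*2.+1 by lia.
by rewrite mulSn -doubleMl addnC.
Qed.

(** The second clause ensures that no update increases a label, whichever region it concerns; the
    third ties the size of a label to the number of finite labels in its region. *)
Definition good lam :=
  [/\ forall u : XV G, Xowner u \in u.2 -> lam u = Some 0,
      forall u, ele (Phi lam u) (lam u) &
      forall (u : XV G) x, lam u = Some x ->
        x <= region_bound #|~: u.2| (numfin lam u.2)].

Lemma good_bound lam u x :
  good lam -> lam u = Some x -> x <= gbound n #|~: u.2|.
Proof.
move=> [own _ bnd] E; case ou: (Xowner u \in u.2).
  by have := own u ou; rewrite E => -[->].
(* [gbound] agrees with [region_bound] only for a positive number of missing players. *)
have : 0 < #|~: u.2| by apply/card_gt0P; exists (Xowner u); rewrite inE ou.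
have := bnd _ _ E; case: #|_| => // d le _; apply: leq_trans le _.
apply: (region_bound_mono (m' := n) d.+1).
exact: max_card.
Qed.

(** With [K] the bound on the present labels of the region, [cost_bound] and the [1 +] of the update
    yield the next iterate of [2 * K + c]. *)
Lemma supcost_bound lam i (u u' : XV G) c :
  good lam -> i \notin u.2 -> Xedge u u' -> supcost lam i u' = Some c ->
  c.+1 <= region_bound #|~: u.2| (numfin lam u.2).+1.
Proof.
move=> gl iu uu' /esup_Some[ubc least]; rewrite region_boundS addnA addnS addSn ltnS.
apply: least => _ [r [pr r0 cr ->]].
have una : unavoidable lam i (r 0).
  move=> r' pr' r0' cr' cN; have := ubc None; apply.
  by exists r'; split=> //; rewrite r0' r0.
apply: (cost_bound una pr cr iu).
- by have /andP[_ /eqP E] := uu'; rewrite r0 E subsetUl.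
- by move=> w x <-; case: gl => _ _; apply.
- move=> w x uw /(good_bound gl) le; apply: leq_trans le _; apply: gbound_mono.
  have : #|~: w.2| < #|~: u.2|.
    by apply: proper_card; move: uw; rewrite /proper !setCS.
  lia.
Qed.

Lemma good_Phi_bound lam u x :
  good lam -> Phi lam u = Some x ->
  x <= region_bound #|~: u.2| (numfin lam u.2).+1.
Proof.
move=> gl; rewrite /Phi; case: ifP => [_ [<-] //|/negbT ou].
case E: (foldr _ _ _) => [c|] //= [<-].
have [u' + E'] := foldr_emin_Some E; rewrite mem_enum => uu'.
by apply: supcost_bound E'; rewrite ?ou.
Qed.

Lemma update_le Js lam l u : good lam -> ele (update Js lam l u) (lam u).
Proof. by move=> [_ le _]; rewrite updateE; case: ifP => // _; apply: ele_refl. Qed.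

Lemma numfin_update Js lam l I :
  good lam -> numfin lam I <= numfin (update Js lam l) I.
Proof.
move=> gl; apply: subset_leq_card; apply/subsetP => v; rewrite !inE.
by have := update_le Js l (v, I) gl; case: (lam _) (update _ _ _ _) => [a|] [b|].
Qed.

(** A label that was finite does not grow; one that turns finite raises [numfin] of its region,
    which pays for the [.+1] in [good_Phi_bound]. *)
Lemma good_update Js lam l : good lam -> good (update Js lam l).
Proof.
move=> gl; have [own le bnd] := gl; split=> [u ou|u|u x Eu].
- by rewrite updateE /Phi ou own // if_same.
(* The new label is either [Phi lam u] or the old one, and both are at least [Phi lam u]. *)
- apply: (@ele_trans (Phi lam u)).
    by apply: Phi_mono => w; apply: update_le.
  by rewrite updateE; case: ifP => // _; apply: ele_refl.
have mono := numfin_update Js l u.2 gl.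
case E: (lam u) => [y|].
  have xy : x <= y by have := update_le Js l u gl; rewrite Eu E.
  apply: leq_trans xy _; apply: leq_trans (bnd _ _ E) _.
  exact: region_bound_mono.
have PE : Phi lam u = Some x by move: Eu; rewrite updateE E; case: ifP.
apply: leq_trans (good_Phi_bound gl PE) _; apply: region_bound_mono.
apply: proper_card; apply/properP; split.
  apply/subsetP => v; rewrite !inE.
  by have := update_le Js l (v, u.2) gl; case: (lam _) (update _ _ _ _) => [a|] [b|].
by exists u.1; rewrite inE -surjective_pairing ?Eu ?E.
Qed.

Lemma good_lam0 : good (@lam0 G).
Proof.
split=> u; rewrite /lam0 /Phi; first by move=> ->.
  by case: ifP => // _; case: (eS _).
by move=> x; case: ifP => // _ [<-].
Qed.

Lemma lamS Js k : exists l, lam Js k.+1 = update Js (lam Js k) l.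
Proof. by rewrite /lam /=; case: (lseq Js k) => f l; exists l. Qed.

Lemma good_lam Js k : good (lam Js k).
Proof.
elim: k => [|k IH]; first exact: good_lam0.
by have [l ->] := lamS Js k; apply: good_update.
Qed.

Lemma lam_le Js k u : ele (lam Js k.+1 u) (lam Js k u).
Proof. by have [l ->] := lamS Js k; apply: update_le; apply: good_lam. Qed.

(** * Stabilisation and existence of the indices [k^*] *)

(** The default exceeds every finite label, so that a label turning finite also lowers the sum. *)
Definition potential Js k :=
  \sum_u odflt (gbound n #|~: u.2|).+1 (lam Js k u).

Lemma potential_unstable Js k :
  ~~ stableAt Js k -> potential Js k.+1 < potential Js k.
Proof.
have le u : odflt (gbound n #|~: u.2|).+1 (lam Js k.+1 u)
    <= odflt (gbound n #|~: u.2|).+1 (lam Js k u) ?= iff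
    (lam Js k.+1 u == lam Js k u).
  have := lam_le Js k u; have := @good_bound _ u ^~ (good_lam Js k.+1).
  case: (lam Js k.+1 u) (lam Js k u) => [a|] [b|] bnd //=; split; rewrite ?eqxx //.
  - exact: leqW (bnd a erefl).
  - by apply/eqP => E; have := bnd a erefl; rewrite E ltnn.
move=> unst; rewrite /potential.
rewrite (ltn_leqif (leqif_sum (P := predT) (fun u _ => le u))).
exact: unst.
Qed.

Lemma stable_after Js k0 : exists2 k, k0 < k & stableAt Js k.
Proof.
move: {2}(potential Js k0.+1) (leqnn (potential Js k0.+1)) => p.
elim: p k0 => [|p IH] k0 le; have [|unst] := boolP (stableAt Js k0.+1).
- by exists k0.+1.
- by have := potential_unstable unst; lia.
- by exists k0.+1.
have [|k kk st] := IH k0.+1; last by exists k => //; lia.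
by have := potential_unstable unst; lia.
Qed.

Lemma kstar_exists Js d : exists k, kstar_d Js d k.
Proof.
elim: d => [|d [k' Hk']]; first by exists 0.
have ex : exists k, (k' < k) && stableAt Js k.
  by have [k kk st] := stable_after Js k'; exists k; rewrite kk.
case: (ex_minnP ex) => k /andP[kk st] least; exists k, k'; split=> // j /andP[kj jk].
by apply/negP => sj; have := least j; rewrite kj sj => /(_ isT); rewrite leqNgt jk.
Qed.

(** * Bounds on the maximal finite range *)

(** Regions enter only through the number [d] of missing players, so all three bounds are
    instances. *)
Lemma mR_le (A : pred (XV G)) Js k d :
  2 <= n -> #|gPi G| <= n -> (forall u : XV G, A u -> #|~: u.2| <= d) -> d <= n ->
  mR_on A (lam Js k) <= n ^ ((n + 3) * (d + 2)).
Proof.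
move=> n2 Pn Ad dn; apply: leq_trans (gbound_le n2 dn).
apply/bigmax_leqP => u /Ad ud; case E: (lam Js k u) => [x|] //=.
exact: leq_trans (good_bound (good_lam Js k) E) (gbound_mono n ud).
Qed.
End Game.

Theorem theorem3p10 :
  exists C : nat,
  forall (G : game) (Js : seq {set gPi G}),
    (2 <= #|gV G|)%N ->
    (#|gPi G| <= #|gV G|)%N ->
    (forall v : gV G, exists v' : gV G, edge v v') ->
    valid_order Js ->
    (forall l, (1 <= l <= size Js)%N ->
       exists k, [/\ IsKstar Js l k,
         (mR_on (inEq Js l) (lam Js k)
            <= C * #|gV G| ^ ((#|gV G| + 3) * (#|~: Jn Js l| + 2)))%N &
         (mR_on (inGe Js l) (lam Js k)
            <= C * #|gV G| ^ ((#|gV G| + 3) * (#|gPi G| + 2)))%N])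
    /\
    (exists k, IsKstar Js 1 k /\
       (mR_on predT (lam Js k) <= C * #|gV G| ^ ((#|gV G| + 3) * (#|gPi G| + 2)))%N).
Proof.
exists 1 => G Js n2 Pn _ _.
have all_le (u : XV G) : #|~: u.2| <= #|gPi G| by apply: max_card.
split=> [l _|]; last first.
  have [k Hk] := kstar_exists Js (size Js - 1); exists k; split=> //.
  by rewrite mul1n; apply: mR_le.
have [k Hk] := kstar_exists Js (size Js - l); exists k; split=> //.
  rewrite mul1n; apply: mR_le => // [u /andP[uJ /eqP <-]|].
    by rewrite /Jn /= nth_index.
  exact: leq_trans (max_card _) Pn.
by rewrite mul1n; apply: mR_le.
Qed.
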